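(* Let $q$ be a power of $2$ and $m\geq 2$. Let $M(x)=x^{2m}+c_{2m-1}x^{2m-1}+\cdots+c_1x+1\in\mathbb{F}_q[x]$ be a monic self-reciprocal polynomial of degree $2m$ (so $c_i=c_{2m-i}$, and necessarily $c_m=0$), such that $x-1$ divides $M(x)$ with multiplicity exactly two and all roots of $M(x)/(x-1)^2$ are simple. Let $\Phi(x)=x^{q^{2m}}+c_{2m-1}x^{q^{2m-1}}+\cdots+c_1x^q+x$ and \[L(x)=\Phi(x)+t^qx^{q^{m+1}}+tx^{q^{m-1}}\in\mathbb{F}_q(t)[x].\] Let $G$ be the Galois group of $L$ over $\mathbb{F}_q(t)$, acting on the space $V$ of roots of $L$. Then there is a prime ideal of degree $1$ in $\mathbb{F}_q[t]$ whose corresponding Frobenius class in $G$ contains an element a power of which is an orthogonal transvection (with respect to the $G$-invariant nondegenerate quadratic form $Q(\alpha)=t\alpha^{q^m+q^{m-1}}+f(\alpha)$ on $V$, where $f\in\mathbb{F}_q[x]$ is the unique polynomial with $f(0)=0$ and $f^q-f=x^{q^m}\Phi$).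
   Context: A monic polynomial $g$ of degree $d$ with $g(0)\ne0$ is self-reciprocal if $g(x)=x^dg(0)^{-1}g(x^{-1})$. The roots of $L$ form a $2m$-dimensional $\mathbb{F}_q$-space $V$ with linear $G$-action. Frobenius class: for $\mu\in\mathbb{F}_q$ and $I=(t-\mu)$, let $R$ be the integral closure of $\mathbb{F}_q[t]$ in the splitting field $E$, $J$ a prime of $R$ above $I$, $D$ its decomposition group; when the reduction of $L$ mod $I$ has nonzero $x$-coefficient, $D$ is generated by $\sigma$ with $\sigma(z)\equiv z^q\pmod J$ for $z\in R$, and the $G$-conjugacy class of $\sigma$ is the Frobenius class of $I$. An orthogonal transvection is an isometry $\sigma$ of $Q$ with minimal polynomial $(x-1)^2$ and $\sigma-I$ of rank one. *)

(* Defs.v *)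
From HB Require Import structures.
From mathcomp Require Import all_boot all_order all_algebra all_fingroup all_field.
From mathcomp Require Import fraction.
Set Implicit Arguments. Unset Strict Implicit. Unset Printing Implicit Defensive.
Import GRing.Theory.
Local Open Scope ring_scope.

(* Self-reciprocal (paper's definition): g(0) <> 0 and
   g(x) = x^d g(0)^{-1} g(x^{-1}); x^d g(1/x) is the coefficient-reversed
   polynomial Poly (rev g). *)
Definition self_reciprocal (F : fieldType) (g : {poly F}) : Prop :=
  g \is monic /\ g`_0 != 0 /\ g = (g`_0)^-1 *: Poly (rev g).

Section Defs.
Variable F : finFieldType.
Local Notation q := #|F|.
Local Notation K := {fraction {poly F}}.

Definition PhiPoly (M : {poly F}) (m : nat) : {poly F} :=
  \sum_(i < (2 * m).+1) (M`_i)%:P * 'X^(q ^ i).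

Definition fracF (a : {poly F}) : K := @FracField.tofrac {poly F} a.

Definition tK : K := fracF 'X.

Definition polyK (a : {poly F}) : {poly K} := map_poly (fun c => fracF c%:P) a.

Definition LPoly (M : {poly F}) (m : nat) : {poly K} :=
  polyK (PhiPoly M m) + (tK ^+ q)%:P * 'X^(q ^ m.+1) + tK%:P * 'X^(q ^ m.-1).

Variable E : splittingFieldType K.

Definition toE (a : {poly F}) : E := in_alg E (fracF a).
Definition cstE (c : F) : E := toE c%:P.
Definition tE : E := in_alg E tK.

Definition rootsV (M : {poly F}) (m : nat) (a : E) : Prop :=
  root (map_poly (in_alg E) (LPoly M m)) a.

Definition Qform (f : {poly F}) (m : nat) (a : E) : E :=
  tE * a ^+ (q ^ m + q ^ m.-1) + (map_poly cstE f).[a].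

Definition intR (z : E) : Prop :=
  exists p : {poly {poly F}}, p \is monic /\ root (map_poly toE p) z.

Definition primeR (J : E -> Prop) : Prop :=
  (forall z, J z -> intR z) /\
  [/\ J 0,
      (forall x y, J x -> J y -> J (x - y)),
      (forall r x, intR r -> J x -> J (r * x)),
      ~ J 1 &
      (forall x y, intR x -> intR y -> J (x * y) -> J x \/ J y)].

(* J lies above I = (t - mu): J meets F_q[t] exactly in (t - mu) *)
Definition lies_over (J : E -> Prop) (mu : F) : Prop :=
  forall a : {poly F}, J (toE a) <-> root a mu.

Definition in_decomp (J : E -> Prop) (g : gal_of (fullv : {vspace E})) : Prop :=
  forall z, intR z -> (J z <-> J (g z)).

Definition frobenius_at (J : E -> Prop) (s : gal_of (fullv : {vspace E})) : Prop :=
  [/\ in_decomp J s,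
      (forall g, in_decomp J g -> g \in <[s]>%g) &
      (forall z, intR z -> J (s z - z ^+ q))].

(* orthogonal transvection of Q on V: isometry of Q on V, minimal polynomial
   (x-1)^2 on V, and sigma - 1 of rank one on V (F_q-linear maps) *)
Definition orth_transvection (f : {poly F}) (M : {poly F}) (m : nat)
  (s : gal_of (fullv : {vspace E})) : Prop :=
  [/\ (forall a, rootsV M m a -> Qform f m (s a) = Qform f m a),
      (forall a, rootsV M m a -> s (s a - a) - (s a - a) = 0),
      (exists2 a, rootsV M m a & s a - a != 0) &
      (exists2 b : E, b != 0 &
        forall a, rootsV M m a -> exists c : F, s a - a = cstE c * b)].

End Defs.

(* Main.v *)
Require Import Defs.
From HB Require Import structures.
From mathcomp Require Import all_boot all_order all_algebra all_fingroup all_field.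
From mathcomp Require Import fraction.
From mathcomp Require Import boolp classical_sets ring.
Set Implicit Arguments. Unset Strict Implicit. Unset Printing Implicit Defensive.
Import GRing.Theory.
Local Open Scope ring_scope.

(* Take the prime (t), a maximal ideal J of R above it, and its Frobenius s.
   The x-coefficient of L is 1, so V injects into R/J, where s acts as the q-th
   power map and L becomes Phi; hence the minimal polynomial of s on V is M.
   Write M = (x-1)^2 N and let k + 1 be the order of a finite splitting field
   of N.  Then (x-1) N divides x^k - 1, but (x-1)^2 does not since k is odd.  So
   s^k - 1 is nonzero on V with image in ker(s-1), and ker(s-1) is a line because
   modulo J its elements are fixed by z -> z^q, i.e. lie in F_q.  The form Q
   takes values in F_q since Q^q - Q = a^(q^m) L(a), so Galois preserves it. *)

(** * Prime ideals of a subring *)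

Section PrimeIdeal.
Variables (E : idomainType) (R : subringClosed E) (J : zmodClosed E).

(** Closure of [J] under subtraction is carried by its type; the clauses add the rest of
    primality. *)
Definition prime_ideal_in :=
  [/\ {subset J <= R}, {in R & J, forall r x, r * x \in J}, 1 \notin J &
      {in R &, forall x y, x * y \in J -> (x \in J) || (y \in J)}].

Hypothesis prJ : prime_ideal_in.

Lemma polyOver_ideal_mul (p u : {poly E}) :
  p \is a polyOver R -> u \is a polyOver J -> p * u \is a polyOver J.
Proof.
have [_ JM _ _] := prJ; move=> /polyOverP Rp /polyOverP Ju.
by apply/polyOverP => i; rewrite coefM rpred_sum // => j _; apply: JM.
Qed.

(* Gauss: compare the lowest coefficients outside J. *)
Lemma polyOver_ideal_prime (p u : {poly E}) :
  p \is a polyOver R -> u \is a polyOver R -> p * u \is a polyOver J ->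
  (p \is a polyOver J) || (u \is a polyOver J).
Proof.
have [_ JM _ Jpr] := prJ; move=> Rp Ru; apply: contraLR; rewrite negb_or => /andP[].
have low (w : {poly E}) : w \isn't a polyOver J ->
    exists i, w`_i \notin J /\ forall j, (j < i)%N -> w`_j \in J.
  move=> Jw; have ex : exists i, w`_i \notin J.
    apply: contrapT => nex; move/polyOverP: Jw; apply=> i.
    by apply: contrapT => /negP Ji; apply: nex; exists i.
  exists (ex_minn ex); case: ex_minnP => i wi min; split=> // j lt_ji.
  by apply: contraT => /min; rewrite leqNgt lt_ji.
move=> /low[i [pi pj]] /low[j [uj uk]]; apply/polyOverP => /(_ (i + j)%N).
have lt_i : (i < (i + j).+1)%N by rewrite ltnS leq_addr.
rewrite coefM (bigD1 (Ordinal lt_i)) //= addKn.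
rewrite rpredDr => [/(Jpr _ _ (polyOverP Rp i) (polyOverP Ru j))|].
  by rewrite (negPf pi) (negPf uj).
apply: rpred_sum => k ne_k; case: (ltngtP k i) => [lt_ki|lt_ik|eq_ki].
- by rewrite mulrC JM ?(polyOverP Ru) ?pj.
- rewrite JM ?(polyOverP Rp) // uk // ltn_subLR ?ltn_add2r //.
  by rewrite -ltnS.
- by case/eqP: ne_k; apply: val_inj.
Qed.

Lemma ideal_exp_prime x n : x \in R -> x ^+ n \in J -> x \in J.
Proof.
have [_ _ J1 Jpr] := prJ => Rx; elim: n => [|n IHn]; first by rewrite expr0 (negPf J1).
by rewrite exprS => /(Jpr _ _ Rx (rpredX n Rx))/orP[].
Qed.

Lemma prod_polyOver_ideal (I : eqType) (r : seq I) (P : pred I) (w : I -> {poly E}) :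
  (forall i, P i -> w i \is a polyOver R) -> \prod_(i <- r | P i) w i \is a polyOver J ->
  exists2 i, P i & w i \is a polyOver J.
Proof.
have [_ _ J1 _] := prJ; move=> Rw; elim: r => [|i r IHr].
  by rewrite big_nil polyOverC (negPf J1).
rewrite big_cons; case: ifP => // Pi /polyOver_ideal_prime.
by rewrite Rw ?rpred_prod // => /(_ isT isT)/orP[?|/IHr//]; exists i.
Qed.

Lemma prod_ideal (I : eqType) (r : seq I) (P : pred I) (x : I -> E) :
  (forall i, P i -> x i \in R) -> \prod_(i <- r | P i) x i \in J ->
  exists2 i, P i & x i \in J.
Proof.
move=> Rx; rewrite -polyOverC rmorph_prod => /prod_polyOver_ideal[i Pi|i Pi].
  by rewrite polyOverC Rx.
by rewrite polyOverC; exists i.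
Qed.

Lemma ideal_expD x y n : x \in R -> y \in R -> x - y \in J -> x ^+ n - y ^+ n \in J.
Proof.
have [_ JM _ _] := prJ => Rx Ry Jxy.
by rewrite subrXX mulrC JM // rpred_sum // => i _; rewrite rpredM ?rpredX.
Qed.

(** Division by the monic ['X - a%:P] stays over [R]; the induction is Horner's scheme. *)
Lemma polyOver_factor (a : E) (p : {poly E}) n : a \in R -> p \is a polyOver R ->
    (size p <= n.+1)%N ->
  exists p1 : {poly E}, [/\ p1 \is a polyOver R, (size p1 <= n)%N &
    p = p1 * ('X - a%:P) + p.[a]%:P].
Proof.
move=> Ra; elim/poly_ind: p n => [|p c IHp] n Rp szp.
  by exists 0; rewrite rpred0 size_poly0 horner0 mul0r addr0.
have Rp' : p \is a polyOver R.
  by apply/polyOverP => i; move/polyOverP: Rp => /(_ i.+1); rewrite coefD coefMX coefC addr0.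
case: n szp => [|n] szp.
  have p0 : p = 0.
    apply/eqP; rewrite -size_poly_eq0; move: szp.
    by rewrite size_MXaddC; case: ifP => [/andP[/eqP->]|]; rewrite ?size_poly0 // ltnS leqn0.
  by exists 0; rewrite rpred0 size_poly0 p0 mul0r hornerD horner0 hornerC mul0r !add0r.
have szp' : (size p <= n.+1)%N.
  by move: szp; rewrite size_MXaddC; case: ifP => [/andP[/eqP->]|]; rewrite ?size_poly0.
have [p1 [Rp1 szp1 Dp]] := IHp n Rp' szp'.
exists (p1 * 'X + p.[a]%:P); split.
- by rewrite rpredD ?rpredM ?polyOverX ?polyOverC ?rpred_horner.
- by rewrite size_MXaddC; case: ifP.
- by rewrite hornerMXaddC {1}Dp polyCD polyCM; ring.
Qed.

(** Over the domain R/J a nonzero polynomial has at most as many roots as its degree. The quotient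
    stays implicit: roots are split off one at a time, and primality cancels each [b - a], which
    lies outside [J]. *)
Lemma polyOver_ideal_roots (rs : seq E) (p : {poly E}) : {subset rs <= R} ->
    pairwise (fun a b => b - a \notin J) rs ->
    p \is a polyOver R -> (size p <= size rs)%N ->
  (forall a, a \in rs -> p.[a] \in J) -> p \is a polyOver J.
Proof.
have [_ JM _ Jpr] := prJ; elim: rs p => [|a rs IHrs] p Rrs /=.
  by move=> _ _; rewrite leqn0 size_poly_eq0 => /eqP-> _; rewrite rpred0.
move=> /andP[/allP Ja prs] Rp szp Jp.
have Ra : a \in R by rewrite Rrs ?mem_head.
have [p1 [Rp1 szp1 Dp]] := polyOver_factor Ra Rp szp.
have Rrs' : {subset rs <= R} by move=> b rb; rewrite Rrs // inE rb orbT.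
rewrite Dp rpredD ?polyOverC ?Jp ?mem_head //.
rewrite mulrC polyOver_ideal_mul ?polyOverXsubC //.
apply: IHrs => // b rb; have:= Jp b; rewrite inE rb orbT => /(_ isT).
rewrite {1}Dp hornerD hornerC rpredDr ?Jp ?mem_head // hornerM hornerXsubC.
have Rb := Rrs' b rb.
by move=> /(Jpr _ _ (rpred_horner Rp1 Rb) (rpredB Rb Ra)); rewrite (negPf (Ja b rb)) orbF.
Qed.

End PrimeIdeal.

(** * Realizing an endomorphism modulo J by a Galois element *)

Section LiftModulo.
Variables (K : fieldType) (E : splittingFieldType K).
Variables (R : subringClosed E) (J : zmodClosed E).
Hypothesis prJ : prime_ideal_in R J.
Variables (S : {group gal_of {:E}}) (theta : {rmorphism E -> E}).
Hypothesis galR : forall (g : gal_of {:E}) z, z \in R -> g z \in R.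
Hypothesis thetaR : forall z, z \in R -> theta z \in R.
Hypothesis thetaS : forall c, c \in R -> (forall g, g \in S -> g c = c) -> theta c - c \in J.

Lemma map_polyOver (h : {additive E -> E}) p : (forall z, z \in R -> h z \in R) ->
  p \is a polyOver R -> map_poly h p \is a polyOver R.
Proof. by move=> hR /polyOverP Rp; apply/polyOverP => i; rewrite coef_map hR. Qed.

(* The orbit polynomial of the generic combination of the z_i has S-invariant
   coefficients, so modulo J it also vanishes at the theta-image. *)
Lemma lift_mod_seq (zs : seq E) : {subset zs <= R} ->
  exists2 g, g \in S & forall z, z \in zs -> theta z - g z \in J.
Proof.
move=> Rzs; pose u := Poly zs; pose w := map_poly theta u.
have Ru : u \is a polyOver R.
  apply/polyOverP => i; rewrite coef_Poly.
  by have [lti|gei] := ltnP i (size zs); [rewrite Rzs ?mem_nth | rewrite nth_default ?rpred0].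
have Rw : w \is a polyOver R by apply: map_polyOver.
pose H : {poly {poly E}} := \prod_(g in S) ('X - (map_poly g u)%:P).
have RH i : H`_i \is a polyOver R.
  apply/polyOverP: i; rewrite rpred_prod // => g _.
  by rewrite polyOverXsubC map_polyOver //; apply: galR.
have invH g : g \in S -> map_poly (map_poly g) H = H.
  move=> Sg; rewrite rmorph_prod (reindex_inj (mulIg g^-1%g)) /=.
  apply: eq_big => [h|h _]; first by rewrite groupMr ?groupV.
  rewrite rmorphB /= map_polyX map_polyC /=; congr (_ - _%:P); rewrite -map_poly_comp /=.
  by apply: eq_map_poly => z /=; rewrite -galM ?memvf // mulgKV.
have JH i : (map_poly theta H`_i - H`_i) \is a polyOver J.
  apply/polyOverP => j; rewrite coefB coef_map thetaS ?(polyOverP (RH i)) // => g Sg.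
  by rewrite -{2}(invH g Sg) coef_map coef_map.
have H0 : H.[u] = 0.
  rewrite horner_prod (bigD1 1%g) ?group1 //= hornerXsubC.
  suff -> : map_poly (1%g : gal_of {:E}) u = u by rewrite subrr mul0r.
  by apply/polyP => i; rewrite coef_map /= gal_id.
have: H.[w] \is a polyOver J.
  have thetaH0 : (map_poly (map_poly theta) H).[w] = 0.
    by rewrite horner_map /= H0 rmorph0.
  rewrite -[H.[w]]subr0 -thetaH0 -hornerN -hornerD horner_coef rpred_sum // => i _.
  rewrite mulrC (polyOver_ideal_mul prJ) ?rpredX // coefD coefN coef_map /=.
  by rewrite -opprB rpredN.
(* By primality a single factor vanishes modulo [J]; its coefficients give the same [g] for every
   entry of [zs]. *)
rewrite horner_prod => /(prod_polyOver_ideal prJ)[g Sg|g Sg].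
  by rewrite hornerXsubC rpredB // map_polyOver //; apply: galR.
rewrite hornerXsubC => /polyOverP Jg; exists g => // z zsz.
have:= Jg (index z zs); rewrite coefB !coef_map /= coef_Poly nth_index //.
Qed.

(** Finiteness of [S] reduces this to lists: if every [g] failed at some element of [R], one such
    element per [g] would contradict [lift_mod_seq]. It serves twice, to construct a Frobenius
    element and to show that it generates the decomposition group. *)
Lemma lift_mod : exists2 g, g \in S & forall z, z \in R -> theta z - g z \in J.
Proof.
apply: contrapT => noG.
have bad g : g \in S -> exists2 z, z \in R & theta z - g z \notin J.
  move=> Sg; apply: contrapT => nobad; apply: noG; exists g => // z Rz.
  by apply: contrapT => /negP Jz; apply: nobad; exists z.
have [zs Rzs badzs] : exists2 zs : seq E, {subset zs <= R} &
    forall g, g \in enum S -> exists2 z, z \in zs & theta z - g z \notin J.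
  have: {subset enum S <= S} by move=> g; rewrite mem_enum.
  elim: (enum S) => [|g gs IHgs] sub; first by exists nil.
  have [|zs Rzs badzs] := IHgs; first by move=> h gsh; rewrite sub // inE gsh orbT.
  have [z Rz Jz] := bad g (sub g (mem_head _ _)).
  exists (z :: zs) => [y|h]; rewrite inE => /predU1P[->|] //; first exact: Rzs.
    by exists z; rewrite ?mem_head.
  by case/badzs=> y zsy Jy; exists y; rewrite // inE zsy orbT.
have [g Sg good] := lift_mod_seq Rzs.
have [|z zsz] := badzs g; first by rewrite mem_enum.
by rewrite good.
Qed.

End LiftModulo.

(** * The integral closure and a prime above (t) *)

Lemma fraction_numden (A : idomainType) (x : {fraction A}) :
  exists n d : A, d != 0 /\ x * FracField.tofrac d = FracField.tofrac n.
Proof.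
elim/quotW: x => y; exists \n_y, \d_y; split; first exact: denom_ratioP.
unlock FracField.tofrac; rewrite -[LHS]FracField.pi_mul.
apply/eqmodP; rewrite /= FracField.equivfE /FracField.mulf.
rewrite !numden_Ratio ?mulf_neq0 ?oner_neq0 ?denom_ratioP // !mulr1.
by rewrite mulrC.
Qed.

Section Integers.
Variables (F : finFieldType) (E : splittingFieldType {fraction {poly F}}).
Local Notation q := #|F|.
Local Notation toE := (toE E).
Local Notation cstE := (cstE E).

HB.instance Definition _ :=
  GRing.RMorphism.copy toE (in_alg E \o @FracField.tofrac {poly F}).
HB.instance Definition _ := GRing.RMorphism.copy cstE (toE \o polyC).

Lemma toE_inj : injective toE.
Proof. by move=> a b /fmorph_inj/eqP; rewrite tofrac_eq => /eqP. Qed.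

Lemma gal_toE (g : gal_of {:E}) a : g (toE a) = toE a.
Proof. by rewrite /toE /= linearZ /= rmorph1. Qed.

Lemma gal_cstE (g : gal_of {:E}) c : g (cstE c) = cstE c.
Proof. exact: gal_toE. Qed.

Lemma cstE_expq c n : cstE c ^+ (q ^ n) = cstE c.
Proof.
rewrite -rmorphXn; congr cstE.
by elim: n => [|n IHn]; rewrite ?expr1 // expnSr exprM IHn expf_card.
Qed.

(** This is the factorization of X^q - X evaluated at [z]. It turns z^q = z, in [E] or modulo a
    prime, into equality with a constant. *)
Lemma prod_sub_cstE z : \prod_c (z - cstE c) = z ^+ q - z.
Proof.
have /(congr1 (fun p => (map_poly cstE p).[z])) := finField_genPoly F.
rewrite rmorphB rmorph_prod /= map_polyXn map_polyX hornerD hornerN hornerXn hornerX => ->.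
rewrite horner_prod; apply: eq_bigr => c _.
by rewrite rmorphB /= map_polyX map_polyC hornerXsubC.
Qed.

(** A boolean form of [intR], obtained classically, to which a subring structure can be attached. *)
Definition Rint : {pred E} := fun z => `[< intR z >].

Lemma RintP z : reflect (intR z) (z \in Rint).
Proof. exact: asboolP. Qed.

Lemma intRE z : intR z <-> integralOver toE z.
Proof. by split=> [[p [mp pz]]|[p mp pz]]; exists p. Qed.

Lemma Rint_subring : subring_closed Rint.
Proof.
split=> [|x y /RintP/intRE Rx /RintP/intRE Ry|x y /RintP/intRE Rx /RintP/intRE Ry];
  apply/RintP/intRE; [exact: integral1 | exact: integral_sub | exact: integral_mul].
Qed.
HB.instance Definition _ := GRing.isSubringClosed.Build E Rint Rint_subring.

Lemma toE_int a : toE a \in Rint.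
Proof. by apply/RintP/intRE/integral_id. Qed.

Lemma cstE_int c : cstE c \in Rint.
Proof. exact: toE_int. Qed.

Lemma gal_int (g : gal_of {:E}) z : z \in Rint -> g z \in Rint.
Proof.
case/RintP=> p [mp pz]; apply/RintP; exists p; split=> //.
rewrite -(eq_map_poly (gal_toE g)) map_poly_comp.
exact: (rmorph_root g).
Qed.

(** If t r = 1 and p(r) = 0 with [p] monic of degree e, then multiplying by t^e gives a vanishing
    element of F_q[t] whose value at t = 0 is the leading coefficient 1. *)
Lemma t_nonunit r : r \in Rint -> toE 'X * r != 1.
Proof.
case/RintP=> p [mp /eqP pr]; apply/eqP => tr1.
have : toE (\sum_(i < size p) p`_i * 'X^((size p).-1 - i)) = 0.
  rewrite -[RHS](mulr0 (toE 'X ^+ (size p).-1)) -pr horner_coef.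
  rewrite size_map_poly_id0; last by rewrite (monicP mp) rmorph1 oner_neq0.
  rewrite rmorph_sum mulr_sumr; apply: eq_bigr => i _; rewrite coef_map /=.
  rewrite rmorphM rmorphXn /= mulrCA; congr (_ * _).
  have le_i : (i <= (size p).-1)%N by rewrite -ltnS (ltn_predK (ltn_ord i)).
  by rewrite -{2}(subnK le_i) exprD -mulrA -exprMn tr1 expr1n mulr1.
rewrite -(rmorph0 toE) => /toE_inj/(congr1 (horner^~ 0)).
have p_gt0 : (0 < size p)%N by rewrite size_poly_gt0 monic_neq0.
rewrite horner0 horner_sum.
have lt_p : ((size p).-1 < size p)%N by rewrite ltn_predL.
rewrite (bigD1 (Ordinal lt_p)) //= -/(lead_coef p) (monicP mp) subnn expr0 mulr1 hornerC.
rewrite big1 ?addr0 => [/eqP|i ne_i]; first by rewrite oner_eq0.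
rewrite hornerM hornerXn expr0n.
have lt_i : (i < (size p).-1)%N.
  rewrite ltn_neqAle -ltnS (ltn_predK (ltn_ord i)) ltn_ord andbT.
  by apply: contraNneq ne_i => eq_i; apply/eqP/val_inj.
by rewrite subn_eq0 leqNgt lt_i mulr0.
Qed.

Let ideal_over_t (A : set E) :=
  [/\ (forall z, A z -> z \in Rint), A (toE 'X),
      (forall x y, A x -> A y -> A (x - y)),
      (forall r x, r \in Rint -> A x -> A (r * x)) & ~ A 1].

Lemma prime_over_t :
  exists2 J : zmodClosed E, prime_ideal_in Rint J & toE 'X \in J.
Proof.
have [|A [[A0|idA] maxA]] := @Zorn_bigcup E [set A | A = set0 \/ ideal_over_t A]%classic.
- move=> C sCP totC; have [[X [CX [x Xx]]]|noX] :=
    pselect (exists X, C X /\ exists x, X x); last first.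
    by left; apply/seteqP; split=> [x [X CX Xx]|//]; case: noX; exists X; split=> //; exists x.
  have idC Y y : C Y -> Y y -> ideal_over_t Y.
    by move=> CY Yy; case: (sCP Y CY) => // Y0; rewrite Y0 in Yy.
  right; split.
  + by move=> z [Y CY Yz]; have [RY _ _ _ _] := idC Y z CY Yz; apply: RY.
  + by exists X => //; have [] := idC X x CX Xx.
  + move=> y z [Y CY Yy] [Z CZ Zz].
    have [_ _ BY _ _] := idC Y y CY Yy; have [_ _ BZ _ _] := idC Z z CZ Zz.
    case: (totC Y Z CY CZ) => [sYZ|sZY]; first by exists Z => //; apply: BZ => //; apply: sYZ.
    by exists Y => //; apply: BY => //; apply: sZY.
  + by move=> r z Rr [Z CZ Zz]; have [_ _ _ MZ _] := idC Z z CZ Zz; exists Z => //; apply: MZ.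
  + by move=> [Z CZ Z1]; have [_ _ _ _ []] := idC Z 1 CZ Z1.
(* The empty set is not maximal: the principal ideal of t contains it strictly and is proper by
   [t_nonunit]. *)
- pose T : set E := [set z | exists2 r, r \in Rint & z = toE 'X * r]%classic.
  have T1 : T (toE 'X) by exists 1; rewrite ?rpred1 ?mulr1.
  case: (maxA T).
    by rewrite A0; split=> // /(_ _ T1).
  right; split=> //.
  + by move=> _ [r Rr ->]; rewrite rpredM ?toE_int.
  + by move=> _ _ [r Rr ->] [s Rs ->]; exists (r - s); rewrite ?rpredB ?mulrBr.
  + by move=> s _ Rs [r Rr ->]; exists (s * r); rewrite ?rpredM // mulrCA.
  + by case=> r /t_nonunit/eqP nt /esym.
have [RA At AB AM A1] := idA.
have A0 : A 0 by rewrite -(subrr (toE 'X)); apply: AB.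
have AD x y : A x -> A y -> A (x + y).
  by move=> Ax Ay; rewrite -[y]opprK -[- y]sub0r; do 2!apply: (AB) => //.
pose J0 : {pred E} := fun z => `[< A z >].
have J0P z : reflect (A z) (z \in J0) by apply: asboolP.
have J0z : zmod_closed J0.
  by split=> [|x y /J0P Ax /J0P Ay]; apply/J0P => //; apply: AB.
pose J : zmodClosed E := HB.pack J0 (GRing.isZmodClosed.Build E J0 J0z).
exists J; last exact/J0P.
split=> [z /J0P/RA//|r x Rr /J0P Ax| |x y Rx Ry /J0P Axy].
- exact/J0P/AM.
- exact/J0P.
apply/orP; have [Ax|nAx] := pselect (A x); [by left; apply/J0P | right; apply/J0P].
(* For [x] outside [A], maximality forces 1 into A + Rx; multiplying 1 = j + r x by [y] then puts
   [y] in [A]. *)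
pose B : set E := [set z | exists j r, [/\ A j, r \in Rint & z = j + r * x]]%classic.
have [[j [r [Aj Rr D1]]]|nB1] := pselect (B 1).
  rewrite -[y]mul1r D1 mulrDl -mulrA mulrC; apply: AD; first exact: AM.
  exact: AM.
have sAB : (A `<=` B)%classic.
  by move=> z Az; exists z, 0; rewrite rpred0 mul0r addr0.
case: (maxA B).
  by split=> // sBA; apply/nAx/sBA; exists 0, 1; rewrite rpred1 mul1r add0r.
right; split=> //.
- by move=> _ [j [r [Aj Rr ->]]]; rewrite rpredD ?rpredM // RA.
- exact: sAB.
- move=> _ _ [j [r [Aj Rr ->]]] [k [s [Ak Rs ->]]]; exists (j - k), (r - s).
  by rewrite rpredB //; split=> //; [apply: AB | ring].
- move=> s _ Rs [j [r [Aj Rr ->]]]; exists (s * j), (s * r).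
  by rewrite rpredM //; split=> //; [apply: AM | ring].
Qed.

(** * Residues modulo a prime above (t) *)

Section ModJ.
Variable J : zmodClosed E.
Hypotheses (prJ : prime_ideal_in Rint J) (Jt : toE 'X \in J).

Lemma toE_mod a : toE a - cstE a.[0] \in J.
Proof.
have [JR JM _ _] := prJ.
have: root (a - a.[0]%:P) 0 by rewrite rootE !hornerE subrr.
case/factor_theorem=> b; rewrite subr0 => Dab.
by rewrite -rmorphB /= Dab rmorphM /= JM ?toE_int.
Qed.

Lemma cstE_mem c : (cstE c \in J) = (c == 0).
Proof.
have [JR JM J1 _] := prJ; apply/idP/eqP=> [Jc|->]; last by rewrite rmorph0 rpred0.
apply: contraNeq J1 => nz_c; rewrite -(rmorph1 cstE) -(mulVf nz_c) rmorphM.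
by rewrite JM ?cstE_int.
Qed.

Lemma toE_mem a : (toE a \in J) = root a 0.
Proof.
by rewrite rootE -cstE_mem; apply/idP/idP=> Ja;
  [rewrite -(rpredBl _ Ja) | rewrite -(rpredBr _ Ja)]; rewrite toE_mod.
Qed.

Lemma expq_mod z : z \in Rint -> z ^+ q - z \in J -> exists c, z - cstE c \in J.
Proof.
move=> Rz; rewrite -prod_sub_cstE => /(prod_ideal prJ)[c _|c _ Jc]; last by exists c.
by rewrite rpredB ?cstE_int.
Qed.

(** Write z = n'/d' in lowest terms. If d'(0) were 0, then n' = z d' would lie in [J] and 0 would be
    a common root; so d'(0) is invertible and z is congruent to n'(0)/d'(0). *)
Lemma base_int_mod z : z \in Rint -> z \in 1%VS -> exists c, z - cstE c \in J.
Proof.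
have [JR JM J1 Jpr] := prJ; move=> Rz /vlineP[x Dz].
have [n [d [nz_d Dx]]] := fraction_numden x.
have Dzd : z * toE d = toE n.
  by rewrite Dz /toE /fracF -Dx !in_algE -scalerAl mul1r scalerA.
pose g := gcdp n d; pose n' := n %/ g; pose d' := d %/ g.
have co : coprimep n' d' by rewrite coprimep_div_gcd ?nz_d ?orbT.
have nz_g : g != 0 by rewrite gcdp_eq0 negb_and nz_d orbT.
have Dzd' : z * toE d' = toE n'.
  apply: (@mulIf _ (toE g)); first by rewrite -(rmorph0 toE) (inj_eq toE_inj).
  by rewrite -mulrA -!rmorphM !divpK ?dvdp_gcdl ?dvdp_gcdr.
have nz_d' : d'.[0] != 0.
  apply/negP=> d0; have Jn : toE n' \in J by rewrite -Dzd' JM // toE_mem.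
  by move: Jn; rewrite toE_mem => /(coprimep_root co); rewrite d0.
exists (n'.[0] / d'.[0]).
have: (z - cstE (n'.[0] / d'.[0])) * cstE d'.[0] \in J.
  rewrite mulrBl -rmorphM divfK //.
  have -> : z * cstE d'.[0] - cstE n'.[0] =
      (toE n' - cstE n'.[0]) - z * (toE d' - cstE d'.[0]) by rewrite -Dzd'; ring.
  by rewrite rpredB ?toE_mod // JM ?toE_mod.
move/Jpr; rewrite cstE_int rpredB ?cstE_int // cstE_mem (negPf nz_d') orbF.
exact.
Qed.

End ModJ.
End Integers.

(** * Frobenius elements and linearized polynomials *)

(** The fixed field of g h^-1 contains the generators, hence everything. *)
Lemma gal_eq_on_generators (K : fieldType) (E : splittingFieldType K)
    (rs : seq E) (g h : gal_of {:E}) :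
  <<1 & rs>>%VS = {:E}%VS -> {in rs, g =1 h} -> g = h.
Proof.
move=> genE eq_gh; pose U := [set (g * h^-1)%g].
have sEU : ({:E} <= fixedField U)%VS.
  rewrite -[X in (X <= _)%VS]genE; apply/Fadjoin_seqP; split=> [|z rz]; first exact: sub1v.
  apply/fixedFieldP=> [|x /set1P->]; first exact: memvf.
  by rewrite galM ?memvf // eq_gh // -galM ?memvf // mulgV gal_id.
apply/eqP; rewrite eq_mulgV1; apply/gal_eqP => z Ez.
have /mem_fixedFieldP[_ ->] := subvP sEU z Ez; first by rewrite gal_id.
exact: set11.
Qed.

Lemma natr_card_finField (F : finFieldType) : #|F|%:R = 0 :> F.
Proof.
have [p p_pr pcharFp] := finPcharP F; apply/eqP; rewrite -(dvdn_pcharf pcharFp).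
have:= finNzRing_gt1 F; rewrite (card_pprimeChar pcharFp).
by case: (X in (p ^ X)%N) => // k _; rewrite expnS dvdn_mulr.
Qed.

Section Frobenius.
Variables (F : finFieldType) (E : splittingFieldType {fraction {poly F}}).
Local Notation q := #|F|.
Local Notation toE := (@toE F E).
Local Notation cstE := (@cstE F E).
Local Notation Rint := (@Rint F E).

Lemma card_pchar_nat (A : idomainType) (f : {rmorphism F -> A}) n : [pchar A].-nat (q ^ n)%N.
Proof.
have [p p_pr pcharFp] := finPcharP F; rewrite pnatX; apply/orP; left.
rewrite (card_pprimeChar pcharFp) pnatX; apply/orP; left.
by rewrite pnatE //; apply: rmorph_pchar pcharFp.
Qed.

Lemma expq_sub n : zmod_morphism (fun x : E => x ^+ (q ^ n)).
Proof.
move=> x y; have qE := card_pchar_nat cstE n.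
rewrite exprDn_pchar //; congr (_ + _); have := exprDn_pchar (- y) y qE.
rewrite addNr expr0n expn_eq0 -leqn0 leqNgt (ltnW (finNzRing_gt1 F)) /=.
by move=> /esym/eqP; rewrite addr_eq0 => /eqP.
Qed.

(** The exponent is written [q ^ 1] so that additivity is the case n = 1 of [expq_sub]. *)
Definition frobE (x : E) := x ^+ (q ^ 1).
HB.instance Definition _ := GRing.isZmodMorphism.Build E E frobE (expq_sub 1).
Lemma frobE_monoid : monoid_morphism frobE.
Proof. by split=> [|x y]; rewrite /frobE ?expr1n ?exprMn. Qed.
HB.instance Definition _ := GRing.isMonoidMorphism.Build E E frobE frobE_monoid.

Variable J : zmodClosed E.
Hypotheses (prJ : prime_ideal_in Rint J) (Jt : toE 'X \in J).

Definition frobenius_mod (s : gal_of {:E}) :=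
  forall z, z \in Rint -> s z - z ^+ q \in J.

(** Apply [lift_mod] to the q-th power map and the full Galois group: invariants lie in F_q(t), so
    they are congruent to constants, which the q-th power fixes. *)
Lemma frobenius_mod_exists : galois 1 {:E} -> exists s, frobenius_mod s.
Proof.
move=> galE; have fixE := galois_fixedField galE.
have [|||s _ Js] := lift_mod (S := 'Gal({:E} / 1)%G) (theta := frobE) prJ.
- exact: gal_int.
- by move=> z Rz; apply: rpredX.
- move=> c Rc fixc; have [|c0 Jc0] := base_int_mod prJ Jt Rc.
    by rewrite -[1%VS]fixE; apply/fixedFieldP; rewrite ?memvf.
  have -> : frobE c - c = frobE (c - cstE c0) - (c - cstE c0).
    by rewrite rmorphB /= /frobE cstE_expq; ring.
  have [JR JM _ _] := prJ.
  by rewrite rpredB // /frobE expn1 -(ltn_predK (finNzRing_gt1 F)) exprS mulrC JM ?rpredX ?JR.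
by exists s => z /Js; rewrite -rpredN opprB /frobE expn1.
Qed.

(** * The decomposition group of J *)

Section Decomposition.
Variable s : gal_of {:E}.
Hypothesis Js : frobenius_mod s.

Lemma frobenius_decomp z : z \in Rint -> (z \in J) = (s z \in J).
Proof.
move=> Rz; have [JR JM _ _] := prJ; apply/idP/idP => [Jz|Jsz].
  rewrite -(rpredBr _ (_ : z ^+ q \in J)) ?Js //.
  by rewrite -(ltn_predK (finNzRing_gt1 F)) exprSr JM ?rpredX ?JR.
by apply: (ideal_exp_prime (n := q) prJ) => //; rewrite -(rpredBl _ Jsz) Js.
Qed.

Lemma iter_frobenius i z : z \in Rint -> (s ^+ i)%g z - z ^+ (q ^ i) \in J.
Proof.
move=> Rz; elim: i => [|i IHi]; first by rewrite expg0 gal_id expr1 subrr rpred0.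
rewrite expgSr galM ?memvf // expnSr exprM.
have -> : s ((s ^+ i)%g z) - (z ^+ (q ^ i)) ^+ q =
   (s ((s ^+ i)%g z) - ((s ^+ i)%g z) ^+ q) +
   (((s ^+ i)%g z) ^+ q - (z ^+ (q ^ i)) ^+ q) by ring.
have Rsz := gal_int (s ^+ i)%g Rz.
by rewrite rpredD ?Js // (ideal_expD prJ) ?rpredX.
Qed.

(** Apply [lift_mod] to [g] and the cyclic group of [s]: an element c fixed by [s] satisfies c^q = c
    modulo [J], hence is congruent to a constant, which [g] fixes. *)
Lemma decomp_frobenius_power (g : gal_of {:E}) :
  (forall z, z \in J -> g z \in J) ->
  exists2 h, h \in <[s]>%g & forall z, z \in Rint -> g z - h z \in J.
Proof.
move=> gJ.
apply: (lift_mod (S := <[s]>%G) (theta := GRing.RMorphism.clone _ _ (g : E -> E) _) prJ).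
- exact: gal_int.
- exact: gal_int.
move=> c Rc fixc; have sc := fixc s (cycle_id s).
have [|c0 Jc0] := expq_mod prJ Rc.
  by rewrite -rpredN opprB -{1}sc Js.
have -> : g c - c = g (c - cstE c0) - (c - cstE c0).
  by rewrite rmorphB /= gal_cstE; ring.
by rewrite rpredB ?gJ.
Qed.

End Decomposition.

(** * Linearized polynomials over F_q[t] and their roots modulo J *)

Section Linearized.
Variables (n : nat) (d : nat -> {poly F}).
Hypotheses (n_gt0 : (0 < n)%N) (d0 : d 0%N = 1) (dn : d n = 1).

(** Coefficients are taken in F_q[t], so that monicity makes the roots integral. *)
Definition linP : {poly {poly F}} := \sum_(i < n.+1) (d i)%:P * 'X^(q ^ i).
Definition linE (a : E) : E := \sum_(i < n.+1) toE (d i) * a ^+ (q ^ i).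

Let q_gt1 : (1 < q)%N := finNzRing_gt1 F.

Lemma size_linP_low (k : nat) (A : nzRingType) (c : nat -> A) :
  (0 < k)%N -> (size (\sum_(i < k) (c i)%:P * 'X^(q ^ i))%R <= q ^ k)%N.
Proof.
move=> k_gt0; apply: (big_ind (fun p : {poly A} => size p <= q ^ k)%N).
- by rewrite size_poly0.
- by move=> p r sp sr; rewrite (leq_trans (size_polyD _ _)) // geq_max sp.
move=> i _; rewrite mul_polyC (leq_trans (size_scale_leq _ _)) // size_polyXn.
by rewrite ltn_exp2l.
Qed.

Lemma linP_split : linP = 'X^(q ^ n) + \sum_(i < n) (d i)%:P * 'X^(q ^ i).
Proof. by rewrite /linP big_ord_recr /= dn mul1r addrC. Qed.

Lemma linP_size : size linP = (q ^ n).+1.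
Proof.
rewrite linP_split size_polyDl size_polyXn // ltnS.
exact: size_linP_low.
Qed.

Lemma linP_monic : linP \is monic.
Proof.
rewrite linP_split monicE lead_coefDl ?lead_coefXn // size_polyXn ltnS.
exact: size_linP_low.
Qed.

(** Every exponent except q^0 is zero in characteristic p. This yields separability. *)
Lemma deriv_linP : linP^`() = 1.
Proof.
rewrite raddf_sum /= big_ord_recl /= d0 mul1r derivXn expn0 mulr1n expr0 big1 ?addr0 //.
move=> i _; rewrite mul_polyC derivZ derivXn -[_ *+ _]mulr_natr.
suff -> : ((q ^ lift ord0 i)%:R : {poly {poly F}}) = 0 by rewrite mulr0 scaler0.
rewrite /= /bump add1n; have [p p_pr pcharFp] := finPcharP F.
have pP : p \in [pchar {poly {poly F}}].
  by apply: (rmorph_pchar polyC); apply: (rmorph_pchar polyC).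
apply/eqP; rewrite -(dvdn_pcharf pP) expnS dvdn_mulr //.
by rewrite (dvdn_pcharf pcharFp) natr_card_finField.
Qed.

Lemma linP_horner a : (map_poly toE linP).[a] = linE a.
Proof.
rewrite rmorph_sum horner_sum; apply: eq_bigr => i _.
by rewrite rmorphM /= map_polyC map_polyXn hornerCM hornerXn.
Qed.

Lemma linE_sub : zmod_morphism linE.
Proof.
by move=> a b; rewrite -sumrB; apply: eq_bigr => i _; rewrite (expq_sub i) mulrBr.
Qed.
HB.instance Definition _ := GRing.isZmodMorphism.Build E E linE linE_sub.

Lemma linE_cst c a : linE (cstE c * a) = cstE c * linE a.
Proof.
rewrite mulr_sumr; apply: eq_bigr => i _.
by rewrite exprMn cstE_expq mulrCA.
Qed.

Lemma linE_gal (g : gal_of {:E}) a : linE (g a) = g (linE a).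
Proof.
rewrite rmorph_sum; apply: eq_bigr => i _.
by rewrite rmorphM rmorphXn /= gal_toE.
Qed.

Lemma linE_int a : linE a = 0 -> a \in Rint.
Proof.
move=> La; apply/RintP; exists linP; split; first exact: linP_monic.
by rewrite rootE linP_horner La.
Qed.

(* L(x)/x is congruent to its constant term 1 at every element of J. *)
Lemma linE_mem_ideal a : linE a = 0 -> a \in J -> a = 0.
Proof.
move=> La Ja; have [JR JM J1 _] := prJ; apply: contraNeq J1 => nz_a.
pose u := \sum_(i < n) toE (d i.+1) * a ^+ (q ^ i.+1).-1.
(* The exponent q^(i+1) - 1 is positive, so each term of [u] keeps a factor [a] and lies in [J]. *)
have qS i : (q ^ i.+1).-1 = (q ^ i.+1 - 2).+1.
  have: (q ^ 0 < q ^ i.+1)%N by rewrite ltn_exp2l.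
  by case: (q ^ i.+1)%N => [|[|k]] //= _; rewrite subn2.
have Ju : u \in J.
  apply: rpred_sum => i _; rewrite qS exprSr mulrA JM // rpredM ?toE_int //.
  by rewrite rpredX ?JR.
suff : a * (1 + u) = 0.
  by move/eqP; rewrite mulf_eq0 (negPf nz_a) addr_eq0 => /eqP->; rewrite rpredN.
rewrite -La /linE big_ord_recl d0 rmorph1 mul1r expn0 expr1 mulrDr mulr1; congr (_ + _).
rewrite mulr_sumr; apply: eq_bigr => i _; rewrite mulrCA -exprS prednK //.
by rewrite expn_gt0 ltnW.
Qed.

(** * The roots as a module over F_q[x], with x acting as s *)

Section Action.
Variable s : gal_of {:E}.

(** This is h(s) applied to [a]. *)
Definition act (h : {poly F}) (a : E) : E := \sum_(i < size h) cstE h`_i * (s ^+ i)%g a.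

Lemma act_widen k (h : {poly F}) a : (size h <= k)%N ->
  act h a = \sum_(i < k) cstE h`_i * (s ^+ i)%g a.
Proof.
move=> le_hk; rewrite /act (big_ord_widen _ (fun i => cstE h`_i * (s ^+ i)%g a) le_hk).
rewrite big_mkcond; apply: eq_bigr => i _; case: ltnP => // le_hi.
by rewrite nth_default // rmorph0 mul0r.
Qed.

Lemma act_polyD h1 h2 a : act (h1 + h2) a = act h1 a + act h2 a.
Proof.
pose k := maxn (size h1) (size h2).
rewrite !(@act_widen k) ?leq_maxl ?leq_maxr ?size_polyD // -big_split.
by apply: eq_bigr => i _; rewrite coefD rmorphD mulrDl.
Qed.

Lemma act_polyC c a : act c%:P a = cstE c * a.
Proof.
by rewrite (@act_widen 1) ?size_polyC ?leq_b1 // big_ord1 coefC expg0 gal_id.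
Qed.

Lemma act_MX h a : act (h * 'X) a = act h (s a).
Proof.
rewrite (@act_widen (size h).+1); last first.
  by rewrite (leq_trans (size_polyMleq _ _)) // size_polyX addn2.
rewrite big_ord_recl coefMX /= rmorph0 mul0r add0r; apply: eq_bigr => i _.
by rewrite coefMX /= expgS galM ?memvf.
Qed.

Lemma act_sub h : zmod_morphism (act h).
Proof.
by move=> a b; rewrite -sumrB; apply: eq_bigr => i _; rewrite rmorphB mulrBr.
Qed.
HB.instance Definition _ h := GRing.isZmodMorphism.Build E E (act h) (act_sub h).

Lemma act_gal h a : act h (s a) = s (act h a).
Proof.
rewrite rmorph_sum; apply: eq_bigr => i _.
by rewrite rmorphM /= gal_cstE -!galM ?memvf // -expgS -expgSr.
Qed.

Lemma act_polyM h1 h2 a : act (h1 * h2) a = act h1 (act h2 a).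
Proof.
elim/poly_ind: h1 a => [|h1 c IHh] a.
  by rewrite mul0r /act size_poly0 !big_ord0.
rewrite mulrDl -mulrA ['X * h2]mulrC mulrA !act_polyD !act_MX IHh act_gal; congr (_ + _).
rewrite act_polyC mul_polyC (@act_widen (size h2)) ?size_scale_leq // mulr_sumr.
by apply: eq_bigr => i _; rewrite coefZ rmorphM mulrA.
Qed.

Lemma act_Xn_sub1 k a : act ('X^k - 1) a = (s ^+ k)%g a - a.
Proof.
have actXn : act 'X^k a = (s ^+ k)%g a.
  elim: k a => [|k IHk] a; first by rewrite expr0 act_polyC rmorph1 mul1r expg0 gal_id.
  by rewrite exprSr act_MX IHk -galM ?memvf // expgS.
by rewrite act_polyD actXn -polyCN act_polyC rmorphN rmorph1 mulN1r.
Qed.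

Lemma linE_act h a : linE a = 0 -> linE (act h a) = 0.
Proof.
move=> La; rewrite raddf_sum big1 // => i _.
by rewrite /= linE_cst linE_gal La rmorph0 mulr0.
Qed.

Hypothesis Js : frobenius_mod s.

(** Modulo [J] the map s^i is the q^i-th power, so h(s) becomes the linearized polynomial associated
    with [h]. Operator identities thus become polynomial ones. *)
Lemma act_mod (h : {poly F}) a : a \in Rint ->
  act h a - \sum_(i < size h) cstE h`_i * a ^+ (q ^ i) \in J.
Proof.
have [_ JM _ _] := prJ => Ra; rewrite -sumrB rpred_sum // => i _.
by rewrite -mulrBr JM ?cstE_int ?(iter_frobenius Js).
Qed.

Variable M : {poly F}.
Hypotheses (sizeM : size M = n.+1) (dM : forall i, (d i).[0] = M`_i).

(** Since t lies in [J], M(s)a is congruent to [linE a], that is, to 0. It is again a root, and the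
    only root in [J] is 0. *)
Lemma act_char a : linE a = 0 -> act M a = 0.
Proof.
move=> La; have Ra := linE_int La; apply: linE_mem_ideal; first exact: linE_act.
have [_ JM _ _] := prJ.
rewrite -[act M a]subr0 -La /linE -sizeM.
rewrite -[X in X - _](subrK (\sum_(i < size M) cstE M`_i * a ^+ (q ^ i))) -addrA.
rewrite rpredD ?act_mod // -sumrB rpred_sum // => i _.
by rewrite -mulrBl -dM -opprB mulNr rpredN mulrC JM ?rpredX ?toE_mod.
Qed.

Variable rs : seq E.
Hypotheses (rsP : forall a, (a \in rs) = (linE a == 0)) (rs_uniq : uniq rs)
  (rs_size : size rs = (q ^ n)%N).

(** With [act_char], this says that [M] is the minimal polynomial of [s] on the roots. The remainder
    [r] of [h] modulo [M] also kills the roots, so its linearized polynomial [p], of degree below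
    q^n, has q^n distinct roots modulo [J] and vanishes there. *)
Lemma act_dvd h : (forall a, linE a = 0 -> act h a = 0) -> M %| h.
Proof.
move=> h0; have nz_M : M != 0 by rewrite -size_poly_gt0 sizeM.
pose r := h %% M; have szr : (size r <= n)%N by rewrite -ltnS -sizeM ltn_modp.
have r0 a : linE a = 0 -> act r a = 0.
  move=> La; have := h0 a La.
  by rewrite {1}(divp_eq h M) act_polyD act_polyM act_char // raddf0 add0r.
pose p : {poly E} := \sum_(i < n) (cstE r`_i)%:P * 'X^(q ^ i).
have Jp : p \is a polyOver J.
  apply: (polyOver_ideal_roots (rs := rs) prJ).
  - by move=> a; rewrite rsP => /eqP/linE_int.
  (* Distinct roots stay distinct modulo [J], since their difference is itself a root. *)
  - have: uniq rs by []; rewrite uniq_pairwise.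
    apply: (sub_in_pairwise (P := mem rs)); last by apply/allP.
    move=> a b; rewrite /= !rsP => /eqP La /eqP Lb ne_ab; apply: contra ne_ab => Jba.
    by rewrite eq_sym -subr_eq0 (linE_mem_ideal _ Jba) // raddfB /= La Lb subrr.
  - by rewrite rpred_sum // => i _; rewrite rpredM ?polyOverXn // polyOverC cstE_int.
  - by rewrite rs_size; apply: (size_linP_low (fun i => cstE r`_i)).
  move=> a; rewrite rsP => /eqP La; have Ra := linE_int La.
  suff -> : p.[a] = \sum_(i < size r) cstE r`_i * a ^+ (q ^ i).
    by have := act_mod r Ra; rewrite (r0 a La) sub0r rpredN.
  rewrite horner_sum.
  rewrite (big_ord_widen _ (fun i => cstE r`_i * a ^+ (q ^ i)) szr) [RHS]big_mkcond.
  apply: eq_bigr => i _; rewrite hornerCM hornerXn; case: ltnP => // le_ri.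
  by rewrite nth_default // rmorph0 mul0r.
suff r00 : r = 0 by rewrite /dvdp -/r r00.
apply/polyP => i; rewrite coef0; have [lt_in|le_ni] := ltnP i n; last first.
  by rewrite nth_default // (leq_trans szr).
apply/eqP; rewrite -(cstE_mem prJ); have := polyOverP Jp (q ^ i)%N.
rewrite coef_sum (bigD1 (Ordinal lt_in)) //= coefCM coefXn eqxx mulr1 big1 ?addr0 //.
move=> j ne_ji; rewrite coefCM coefXn eqn_exp2l // eq_sym.
by rewrite (negPf (_ : (j : nat) != i)) ?mulr0.
Qed.

(** Fixed roots are congruent to constants ca and cb, with cb nonzero because [b] is not in [J].
    Then a - (ca/cb) b is a root lying in [J], hence 0. *)
Lemma fixed_line a b : linE a = 0 -> linE b = 0 -> s a = a -> s b = b -> b != 0 ->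
  exists c, a = cstE c * b.
Proof.
have [_ JM _ _] := prJ => La Lb sa sb nz_b.
have cst z : linE z = 0 -> s z = z -> exists c, z - cstE c \in J.
  move=> Lz sz; have Rz := linE_int Lz; apply: (expq_mod prJ) => //.
  by rewrite -rpredN opprB -{1}sz Js.
have [[ca Ja] [cb Jb]] := (cst a La sa, cst b Lb sb).
have nz_cb : cb != 0.
  apply: contraNneq nz_b => cb0; rewrite cb0 rmorph0 subr0 in Jb.
  by rewrite (linE_mem_ideal Lb Jb).
exists (ca / cb); apply/eqP; rewrite -subr_eq0; apply/eqP/linE_mem_ideal.
  by rewrite raddfB /= linE_cst La Lb mulr0 subrr.
have -> : a - cstE (ca / cb) * b = (a - cstE ca) - cstE (ca / cb) * (b - cstE cb).
  by rewrite mulrBr -rmorphM divfK //; ring.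
by rewrite rpredB ?JM ?cstE_int.
Qed.

End Action.
End Linearized.
End Frobenius.

(** * The polynomial L and the form Q *)

(* k + 1 is the order of a finite splitting field of N. *)
Lemma unipotent_exponent (F : finFieldType) (N : {poly F}) :
    separable_poly N -> N.[0] != 0 -> N.[1] != 0 ->
  exists2 k, ('X - 1) * N %| 'X^k - 1 & ~~ (('X - 1 : {poly F}) ^+ 2 %| 'X^k - 1).
Proof.
move=> sepN N0 N1; have nz_N : N != 0 by apply: contraNneq N0 => ->; rewrite horner0.
have [L [zs DN _]] := FinSplittingFieldFor nz_N.
pose Q : finFieldType := FinFieldExtType L; pose k := #|Q|.-1.
have Qk : #|Q| = k.+1 by rewrite prednK // ltnW // finNzRing_gt1.
have uzs : uniq zs.
  rewrite -separable_prod_XsubC -(eqp_separable DN) separable_map.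
  exact: sepN.
have dvdQ : N %| 'X^(k.+1) - 'X.
  rewrite -(dvdp_map (in_alg L)) (eqp_dvdl _ DN) rmorphB /= map_polyXn map_polyX.
  apply: uniq_roots_dvdp; last by rewrite uniq_rootsE.
  apply/allP=> z _; rewrite rootE !hornerE -Qk.
  by rewrite (expf_card (z : Q)) subrr.
have dvdk : N %| 'X^k - 1.
  rewrite -(@Gauss_dvdpr _ _ 'X); first by rewrite mulrBr -exprS mulr1.
  by rewrite -['X]subr0 coprimep_XsubC rootE.
have co1 : coprimep ('X - 1) N by rewrite coprimep_sym coprimep_XsubC rootE.
exists k.
  rewrite Gauss_dvdp // dvdk andbT -[in 'X - 1]polyC1 dvdp_XsubCl rootE !hornerE expr1n.
  by rewrite subrr.
(* A double root at 1 would make the derivative of X^k - 1 vanish there, so k = 0 in [F]; but k + 1,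
   the order of [Q], is also 0 in [Q], giving 1 = 0. *)
apply/negP => /dvdpP[u Du].
have kF : k%:R = 0 :> F.
  have -> : k%:R = ('X^k - 1 : {poly F})^`().[1].
    by rewrite derivB derivXn derivC subr0 hornerMn hornerXn expr1n.
  by rewrite Du expr2 !derivM !hornerE subrr /= !(mulr0, mul0r, addr0).
have k0 : k%:R = 0 :> L by rewrite -(rmorph_nat (in_alg L)) kF rmorph0.
have := natr_card_finField Q; rewrite Qk mulrS.
have -> : (k%:R : Q) = 0 by exact: k0.
by move/eqP; rewrite addr0 oner_eq0.
Qed.

Section Main.
Variables (F : finFieldType) (E : splittingFieldType {fraction {poly F}}).
Local Notation q := #|F|.
Local Notation toE := (@toE F E).
Local Notation cstE := (@cstE F E).
Local Notation tE := (@tE F E).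
Variables (M : {poly F}) (m : nat).

Lemma map_polyK p : map_poly (in_alg E) (polyK p) = map_poly cstE p.
Proof.
apply/polyP => i; rewrite coef_map [LHS]/= coef_map_id0 ?coef_map //.
Qed.

Lemma LPoly_horner a : (map_poly (in_alg E) (LPoly M m)).[a] =
  (map_poly cstE (PhiPoly M m)).[a] + tE ^+ q * a ^+ (q ^ m.+1) + tE * a ^+ (q ^ m.-1).
Proof.
rewrite /LPoly !rmorphD !rmorphM /= !map_polyC !map_polyXn /= !hornerE /=.
congr (_ + _ + _); last by rewrite -in_algE rmorphXn.
by rewrite map_polyK.
Qed.

(** These are the coefficients of L as a linearized polynomial. For m at least 2 the indices m - 1
    and m + 1 lie strictly between 0 and 2m, so the two end coefficients remain those of [M]. *)
Definition Lcoef i : {poly F} :=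
  (M`_i)%:P + (if i == m.+1 then 'X^q else 0) + (if i == m.-1 then 'X else 0).

Lemma Lcoef_horner0 i : (Lcoef i).[0] = M`_i.
Proof.
have q_gt0 : (0 < q)%N by rewrite ltnW ?finNzRing_gt1.
have q0 : ('X^q : {poly F}).[0] = 0 by rewrite hornerXn expr0n gtn_eqF.
by rewrite !hornerD hornerC !(fun_if (horner^~ 0)) q0 hornerX horner0 !if_same !addr0.
Qed.

Hypothesis m_ge2 : (2 <= m)%N.

Lemma LPoly_linP : map_poly (in_alg E) (LPoly M m) = map_poly toE (linP (2 * m) Lcoef).
Proof.
have lt1 : (m.+1 < (2 * m).+1)%N by rewrite ltnS mul2n -addnn -addn1 leq_add2l ltnW.
have lt2 : (m.-1 < (2 * m).+1)%N by rewrite ltnS (leq_trans (leq_pred m)) // leq_pmull.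
have -> : linP (2 * m) Lcoef = map_poly polyC (PhiPoly M m) +
    ('X^q)%:P * 'X^(q ^ m.+1) + 'X%:P * 'X^(q ^ m.-1).
  rewrite /linP; under eq_bigr do rewrite !polyCD !mulrDl.
  rewrite !big_split /=; congr (_ + _ + _).
  - rewrite rmorph_sum; apply: eq_bigr => i _.
    by rewrite rmorphM /= map_polyC map_polyXn.
  - rewrite (bigD1 (Ordinal lt1)) //= eqxx big1 ?addr0 // => i ne_i.
    by rewrite (negPf (_ : (i : nat) != m.+1)) // mul0r.
  - rewrite (bigD1 (Ordinal lt2)) //= eqxx big1 ?addr0 // => i ne_i.
    by rewrite (negPf (_ : (i : nat) != m.-1)) // mul0r.
rewrite /LPoly !rmorphD !rmorphM /= !map_polyC !map_polyXn /=.
congr (_ + _ + _).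
  by rewrite map_polyK -map_poly_comp.
by rewrite -in_algE [toE _]rmorphXn rmorphXn.
Qed.

(** Both sides are equal because Q(a) is a constant: Q(a)^q - Q(a) = a^(q^m) L(a) = 0. *)
Lemma Qform_gal (f : {poly F}) (g : gal_of {:E}) a : 2%N \in [pchar F] ->
    f ^+ q - f = 'X^(q ^ m) * PhiPoly M m -> rootsV M m a ->
  Qform f m (g a) = Qform f m a.
Proof.
move=> char2 hf /eqP La; set Qa := Qform f m a.
have gQ : g Qa = Qform f m (g a).
  rewrite /Qa /Qform rmorphD rmorphM /= rmorphXn /= (gal_toE g 'X).
  rewrite -horner_map -map_poly_comp; congr (_ + (_ : {poly E}).[_]).
  by apply: eq_map_poly => c; apply: gal_cstE.
suff [c Dc] : exists c, Qa = cstE c by rewrite -gQ Dc gal_cstE.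
have : \prod_c (Qa - cstE c) = 0.
  rewrite prod_sub_cstE; have char2E := rmorph_pchar cstE char2.
  have -> : Qa ^+ q = frobE Qa by rewrite /frobE expn1.
  rewrite /Qa /Qform rmorphD /= /frobE expn1 exprMn -exprM mulnDl -!expnSr.
  have -> : (map_poly cstE f).[a] ^+ q =
      (map_poly cstE f).[a] + a ^+ (q ^ m) * (map_poly cstE (PhiPoly M m)).[a].
    rewrite -horner_exp -rmorphXn -[f ^+ q](subrK f) hf addrC rmorphD rmorphM /= map_polyXn.
    by rewrite hornerD hornerM hornerXn.
  rewrite prednK ?(ltnW m_ge2) // !exprD.
  have := LPoly_horner a; rewrite La; set P := (map_poly cstE (PhiPoly M m)).[a] => /esym/eqP.
  rewrite addr_eq0 => /eqP DL.
  have -> : P = - (tE * a ^+ (q ^ m.-1)) - tE ^+ q * a ^+ (q ^ m.+1) by rewrite -DL addrK.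
  set A := a ^+ (q ^ m); set B := a ^+ (q ^ m.-1); set C := a ^+ (q ^ m.+1).
  set f' := _.[a].
  (* Q^q - Q produces the term in t with a minus sign where L has a plus; characteristic two
     reconciles them. *)
  have -> : - (tE * B) = tE * B by exact: (oppr_pchar2 char2E).
  by ring.
by move/eqP/prodf_eq0 => [c _]; rewrite subr_eq0 => /eqP ->; exists c.
Qed.
End Main.

(** * The Frobenius class at (t) and its transvection *)

Theorem theorem4p10
  (F : finFieldType) (char2 : 2%N \in [pchar F])
  (m : nat) (hm : (2 <= m)%N)
  (M : {poly F})
  (hMsize : size M = (2 * m).+1)
  (hMself : self_reciprocal M)
  (hM1 : M`_0 = 1)
  (hmult2 : ('X - 1) ^+ 2 %| M)
  (hmult3 : ~~ (('X - 1) ^+ 3 %| M))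
  (hsimple : separable_poly (M %/ ('X - 1) ^+ 2))
  (E : splittingFieldType {fraction {poly F}})
  (hE : splittingFieldFor 1%VS (map_poly (in_alg E) (LPoly M m)) fullv)
  (f : {poly F})
  (hf0 : f.[0] = 0)
  (hf : f ^+ #|F| - f = 'X^(#|F| ^ m) * PhiPoly M m) :
  exists mu : F, exists J : E -> Prop,
    [/\ primeR J, lies_over J mu &
      exists s : gal_of (fullv : {vspace E}),
        frobenius_at J s /\
        exists k : nat, orth_transvection f M m (s ^+ k)%g].
Proof.
set N := M %/ ('X - 1) ^+ 2 in hsimple.
have DM : M = N * ('X - 1) ^+ 2 by rewrite divpK.
have N0 : N.[0] != 0.
  apply: contra_eq_neq hM1 => N0; rewrite -horner_coef0 DM hornerM N0 mul0r.
  by rewrite eq_sym oner_neq0.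
have N1 : N.[1] != 0.
  apply: contraNneq hmult3 => /eqP; rewrite -/(root N 1) -dvdp_XsubCl polyC1 => dvdN.
  by rewrite DM exprS dvdp_mul.
have [k dvdk ndvdk] := unipotent_exponent hsimple N0 N1.
pose n := (2 * m)%N; pose d := Lcoef M m.
have n_gt0 : (0 < n)%N by rewrite muln_gt0 (ltnW hm).
have d0 : d 0%N = 1.
  by rewrite /d /Lcoef hM1 polyC1; case: (m) hm => [|[|m']] //; rewrite !addr0.
have dn : d n = 1.
  have -> : d n = (M`_n)%:P.
    have lt_n : (m.+1 < n)%N by rewrite /n mul2n -addnn -addn1 ltn_add2l.
    rewrite /d /Lcoef (gtn_eqF lt_n) gtn_eqF ?addr0 //.
    exact: leq_ltn_trans (leq_pred m) (ltnW lt_n).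
  by have [/monicP] := hMself; rewrite lead_coefE hMsize /= => ->.
have [rs DL genE] := hE; rewrite LPoly_linP // in DL.
pose LE : {poly E} := map_poly (@toE F E) (linP n d).
(* Derivative 1 makes L separable: [E] is Galois and L has exactly q^(2m) distinct roots. *)
have dLE : LE^`() = 1 by rewrite deriv_map deriv_linP // rmorph1.
have sepLE : separable_poly LE by rewrite unlock dLE coprimep1.
have VE a : rootsV M m a <-> linE n d a = 0.
  by rewrite /rootsV LPoly_linP // rootE linP_horner; split=> /eqP.
have rsP a : (a \in rs) = (linE n d a == 0).
  by rewrite -root_prod_XsubC -(eqp_root DL) rootE linP_horner.
have rs_uniq : uniq rs by rewrite -separable_prod_XsubC -(eqp_separable DL).
have rs_size : size rs = (#|F| ^ n)%N.
  have := eqp_size DL; rewrite size_prod_XsubC size_map_inj_poly ?rmorph0 //;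
    last exact: toE_inj.
  by rewrite linP_size // => -[].
have galE : galois 1 {:E}.
  apply/splitting_galoisField; exists LE; split=> //.
    rewrite /LE -LPoly_linP //; exact: alg_polyOver.
  by rewrite /LE -LPoly_linP.
have [J prJ Jt] := prime_over_t E.
have [JR JM J1 Jpr] := prJ.
have [s Js] := frobenius_mod_exists prJ Jt galE.
(* The prime is (t), that is, mu = 0. *)
exists 0, (fun z => z \in J); split.
- split; first by move=> z /JR/RintP.
  split; [exact: rpred0 | exact: rpredB | | exact/negP |].
  + by move=> r x /RintP Rr; apply: JM.
  + by move=> x y /RintP Rx /RintP Ry /(Jpr _ _ Rx Ry)/orP.
- by move=> a; rewrite toE_mem.
exists s; split.
  split.
  - by move=> z /RintP Rz; rewrite -(frobenius_decomp prJ Js).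
  - move=> g Dg; have [|h sh Jgh] := decomp_frobenius_power prJ Js (g := g).
      by move=> z Jz; have /Dg[/(_ Jz)] : intR z by apply/RintP/JR.
    (* Congruence modulo [J] becomes equality: on a root z of L, g z - h z is a root lying in [J],
       hence 0, and the roots generate [E]. *)
    suff -> : g = h by [].
    apply: (gal_eq_on_generators genE) => z; rewrite rsP => /eqP Lz.
    apply/eqP; rewrite -subr_eq0; apply/eqP; apply: (linE_mem_ideal prJ (n := n) d0).
      by rewrite raddfB /= !linE_gal Lz !rmorph0 subrr.
    by apply/Jgh/(linE_int n_gt0 dn).
  - by move=> z /RintP; apply: Js.
exists k.
have dM i : (d i).[0] = M`_i by apply: Lcoef_horner0.
have actM a := @act_char _ _ _ prJ Jt n d n_gt0 d0 dn s Js M hMsize dM a.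
have fix_s a : linE n d a = 0 -> s ((s ^+ k)%g a - a) = (s ^+ k)%g a - a.
  move=> La; apply/eqP; rewrite -subr_eq0 -{1}[s]expg1 -act_Xn_sub1 -act_Xn_sub1 -act_polyM.
  (* [M] is (x-1) times (x-1)N, and the latter divides x^k - 1. *)
  have /dvdpP[u ->] : M %| ('X^1 - 1) * ('X^k - 1).
    by rewrite DM expr1 exprS expr1 mulrCA dvdp_mul // mulrC.
  by rewrite act_polyM actM // raddf0.
have fixk b : s b = b -> (s ^+ k)%g b = b.
  by move=> sb; elim: (k) => [|j IHj]; rewrite ?gal_id // expgS galM ?memvf // sb.
(* If s^k were the identity on the roots, [M], and with it (x-1)^2, would divide x^k - 1. *)
have [a0 La0 nz0] : exists2 a, linE n d a = 0 & (s ^+ k)%g a - a != 0.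
  apply: contrapT => no; case/negP: ndvdk.
  apply: dvdp_trans hmult2 _.
  apply: (act_dvd prJ Jt n_gt0 d0 dn Js hMsize dM rsP rs_uniq rs_size) => a La.
  by rewrite act_Xn_sub1; apply: contrapT => /eqP ne; apply: no; exists a.
split.
- by move=> a; apply: Qform_gal.
- by move=> a /VE La; rewrite fixk ?subrr // fix_s.
- by exists a0 => //; apply/VE.
(* The image of s^k - 1 lies in ker(s - 1), so this one nonzero value spans it by [fixed_line]. *)
exists ((s ^+ k)%g a0 - a0) => // a /VE La.
apply: (fixed_line prJ n_gt0 d0 dn (n := n) (d := d) Js); rewrite ?fix_s //.
  by rewrite raddfB /= linE_gal La rmorph0 subrr.
by rewrite raddfB /= linE_gal La0 rmorph0 subrr.
Qed.
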